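(* Let $A, B, C, D \in \mathbb{C}$ with $B - AC \neq 0$, and write $B - AC = re^{i\theta}$ with $r > 0$ and $\theta \in \mathbb{R}$. Then the solution set of the inequality $\frac{AZ+B}{Z+C} \geq D$ is $$\left\{Z \in \mathbb{C} : Z \neq -C,\ \frac{AZ+B}{Z+C} \geq D\right\} = e^{i\theta}\cdot\frac{1}{\mathscr{D}\left(\frac{D-A}{r}\right)} - C.$$
   Context: The relation $\geq$ on $\mathbb{C}$ is defined as follows: for $A = a_1 + a_2 i$, $B = b_1 + b_2 i$ with $a_1,a_2,b_1,b_2 \in \mathbb{R}$, $A \geq B$ means: $a_1 > b_1$, or ($a_1 = b_1$ and $a_2 \geq b_2$). For $A \in \mathbb{C}$, $\mathscr{D}(A) := \{Z \in \mathbb{C} : Z \geq A\}$. For $\mathscr{B} \subset \mathbb{C}$, $\theta \in \mathbb{R}$ and $A \in \mathbb{C}$: the rotation set is $e^{i\theta}\mathscr{B} := \{Ze^{i\theta} : Z \in \mathscr{B}\}$ (also written $\mathscr{B}\cdot e^{i\theta}$); the translation set is $\mathscr{B} + A := \{Z + A : Z \in \mathscr{B}\}$, and $\mathscr{B} - A := \mathscr{B} + (-A)$; the inversion set is $1/\mathscr{B} := \{1/Z : Z \in \mathscr{B},\ Z \neq 0\}$. *)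

(* Defs.v *)
From HB Require Import structures.
From mathcomp Require Import all_boot all_order all_algebra.
From mathcomp Require Import complex.
From mathcomp Require Import boolp classical_sets reals trigo.

Set Implicit Arguments.
Unset Strict Implicit.
Unset Printing Implicit Defensive.

Import Order.TTheory GRing.Theory Num.Theory.

Local Open Scope classical_set_scope.
Local Open Scope ring_scope.
Local Open Scope complex_scope.

(* Lexicographic order on the complex numbers.  It is not the order [<=%R] that
   [R[i]] carries as a number domain, which is partial: there, comparable
   numbers have equal imaginary parts. *)
Definition lexge (R : realType) (A B : R[i]) : Prop :=
  complex.Re A > complex.Re B \/
  (complex.Re A = complex.Re B /\ complex.Im A >= complex.Im B).

Definition lexup (R : realType) (A : R[i]) : set R[i] := [set Z | lexge Z A].

Definition expi (R : realType) (theta : R) : R[i] := cos theta +i* sin theta.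

Definition rotset (R : realType) (theta : R) (S : set R[i]) : set R[i] :=
  [set Z * expi theta | Z in S].

Definition transset (R : realType) (S : set R[i]) (A : R[i]) : set R[i] :=
  [set Z + A | Z in S].

Definition invset (R : realType) (S : set R[i]) : set R[i] :=
  [set 1 / Z | Z in [set Z | S Z /\ Z != 0]].

(* Main.v *)
Require Import Defs.
From mathcomp Require Import all_boot all_order all_algebra.
From mathcomp Require Import complex.
From mathcomp Require Import boolp classical_sets reals trigo.
From mathcomp Require Import ring.

Import Order.TTheory GRing.Theory Num.Theory.

Local Open Scope classical_set_scope.
Local Open Scope ring_scope.
Local Open Scope complex_scope.

(** Write [E] for [expi theta].  For [Z != - C], division with remainder gives
    [(A * Z + B) / (Z + C) = A + (B - A * C) / (Z + C) = A + r%:C * W], where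
    [W = E / (Z + C)].  The lexicographic order is invariant under translations
    and under dilations by positive reals (though not under multiplication by
    other complex numbers), so the inequality says exactly that [W] is at least
    [(D - A) / r%:C].  Finally [Z |-> W] is a bijection from the complement of
    [- C] onto the nonzero complex numbers, with inverse
    [W |-> 1 / W * E - C], which is the composite of an inversion, a rotation
    and a translation.  The rotation factor is nonzero because [B - A * C] is. *)

Lemma lexgeD2r (R : realType) (T X Y : R[i]) :
  lexge (X + T) (Y + T) <-> lexge X Y.
Proof.
case: T X Y => [t1 t2] [x1 x2] [y1 y2]; rewrite /lexge /= ltrD2r lerD2r.
split=> -[lt_yx | [eq_xy le_yx]]; [by left | right | by left | right].
- by split=> //; exact: addIr eq_xy.
- by rewrite eq_xy.
Qed.

Lemma lexgeM2l (R : realType) (r : R) (X Y : R[i]) : 0 < r ->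
  lexge (r%:C * X) (r%:C * Y) <-> lexge X Y.
Proof.
case: X Y => [x1 x2] [y1 y2] r_gt0.
rewrite /lexge /= !mul0r !subr0 !addr0 ltr_pM2l // ler_pM2l //.
split=> -[lt_yx | [eq_xy le_yx]]; [by left | right | by left | right].
- by split=> //; exact: mulfI (lt0r_neq0 r_gt0) _ _ eq_xy.
- by rewrite eq_xy.
Qed.

Lemma lexge_affine (R : realType) (r : R) (A D W : R[i]) : 0 < r ->
  lexge (A + r%:C * W) D <-> lexge W ((D - A) / r%:C).
Proof.
move=> r_gt0.
have rC_neq0 : r%:C != 0 by rewrite fmorph_eq0 lt0r_neq0.
have D_eq : D = r%:C * ((D - A) / r%:C) + A by field.
by rewrite addrC {1}D_eq lexgeD2r lexgeM2l.
Qed.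

Lemma mobius_split (F : fieldType) (A B C Z : F) : Z + C != 0 ->
  (A * Z + B) / (Z + C) = A + (B - A * C) / (Z + C).
Proof. by move=> ZC_neq0; field. Qed.

Theorem mainTheorem11 (R : realType) (A B C D : R[i]) (r theta : R)
  (hBAC : B - A * C != 0) (hr : 0 < r)
  (hpolar : B - A * C = r%:C * expi theta) :
  [set Z : R[i] | Z != - C /\ lexge ((A * Z + B) / (Z + C)) D] =
  transset (rotset theta (invset (lexup ((D - A) / r%:C)))) (- C).
Proof.
have E_neq0 : expi theta != 0.
  by apply: contra_neq hBAC => E0; rewrite hpolar E0 mulr0.
have ineqE Z : Z + C != 0 -> lexge ((A * Z + B) / (Z + C)) D <->
    lexge (expi theta / (Z + C)) ((D - A) / r%:C).
  by move=> ZC_neq0; rewrite mobius_split // hpolar -mulrA lexge_affine.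
apply/seteqP; split=> [Z /= [Z_neq leD] | _ /= [_ [_ [W [leW W_neq0] <-] <-] <-]].
- have ZC_neq0 : Z + C != 0 by rewrite addr_eq0.
  exists (Z + C); last by rewrite addrK.
  exists ((Z + C) / expi theta); last by rewrite divfK.
  exists (expi theta / (Z + C)); last by rewrite div1r invf_div.
  by split; [exact/ineqE | rewrite mulf_neq0 ?invr_eq0].
- have ZC_neq0 : 1 / W * expi theta - C + C != 0.
    by rewrite subrK div1r mulf_neq0 ?invr_eq0.
  split; first by rewrite -addr_eq0.
  apply/(ineqE _ ZC_neq0).
  suff -> : expi theta / (1 / W * expi theta - C + C) = W by [].
  by rewrite subrK; field; rewrite W_neq0.
Qed.
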